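(* Let $n\ge1$, let $s$, $l_i$, $\alpha_{i,j}$ be the data attached to the binary expansion of $n$ as in the context, and put $$l=\max_{1\le i\le s}l_i,\qquad A_j=\sum_{\substack{1\le i\le s\\ l_i\ge j}}\alpha_{i,j}.$$ Then: (a) The $n$th Hankel determinant $\det[d_{i+j}]_{0\le i,j<n}$ of the period-doubling sequence $\mathbf{d}=(d_m)_{m\ge0}$ is $$(-1)^{\frac{(n-1)(n-2)}{2}}J(l_1+1)\prod_{j=1}^lJ(j)^{A_j}.$$ (b) The $n$th Hankel determinant $\det[\bar d_{i+j}]_{0\le i,j<n}$ of the bit-wise negation $\bar{\mathbf{d}}=(\bar d_m)_{m\ge0}$ of the period-doubling sequence is $$(-1)^{\frac{n(n-1)}{2}}J(l_1)\prod_{j=1}^lJ(j)^{A_j}.$$ In particular, the determinant in (b) is nonzero if and only if $n$ is even.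
   Context: The period-doubling sequence is $d_m=(\nu_2(m+1)+1)\bmod2\in\{0,1\}$ for $m\ge0$, where $\nu_2$ is the $2$-adic valuation, and $\bar d_m=1-d_m$. The Jacobsthal numbers are $J(0)=0$, $J(1)=1$, $J(m+2)=J(m+1)+2J(m)$. For $n\ge1$ write the binary expansion (most significant digit on the left) as $$(n)_2=1^{l_s}0^{l_{s-1}}1^{l_{s-2}}\cdots\overline{a}^{\,l_3}a^{l_2}\,1\,0^{l_1},$$ where $s\ge1$, $l_1\ge0$, $l_i\ge1$ for $2\le i\le s$, $a\in\{0,1\}$, $\overline a=1-a$, and $b^m$ means the digit $b$ repeated $m$ times (so the rightmost $1$ followed by $0^{l_1}$ is separated off, and the remaining prefix, empty if $s=1$, is split into maximal alternating runs of lengths $l_s,\ldots,l_2$, the leading one consisting of $1$s). Put $k_1=l_1$, $k_i=1+\sum_{j=1}^il_j$ for $i\ge2$; $\alpha_{i,j}=2^{k_i-j}$ if $1\le j<l_i$; and $\alpha_{1,l_1}=1$, $\alpha_{i,l_i}=2^{l_1+1}$ for $i=2,3$, $\alpha_{i,l_i}=2^{k_{i-2}+1}-\alpha_{i-1,l_{i-1}}$ for $i\ge4$. Empty products equal $1$. *)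

(* Defs.v *)
From HB Require Import structures.
From mathcomp Require Import all_boot all_order all_algebra.
From mathcomp Require Import zify.

Set Implicit Arguments.
Unset Strict Implicit.
Unset Printing Implicit Defensive.

Import Order.TTheory GRing.Theory Num.Theory.

Definition period_doubling (m : nat) : int := ((logn 2 m.+1 + 1) %% 2)%:Z.

Definition period_doubling_neg (m : nat) : int := (1 - period_doubling m)%R.

Definition hankel_det (u : nat -> int) (n : nat) : int :=
  (\det (\matrix_(i < n, j < n) u (i + j)%N))%R.

Fixpoint jacobsthal (m : nat) : nat :=
  match m with
  | 0 => 0
  | m'.+1 => if m' is m''.+1 then jacobsthal m' + 2 * jacobsthal m'' else 1
  end.

(* Words over {0,1} are [seq bool], most significant digit first. *)
Definition binary_value (w : seq bool) : nat :=
  foldl (fun (v : nat) (b : bool) => 2 * v + b) 0 w.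

Definition binary_expansion (n : nat) (w : seq bool) : Prop :=
  head false w /\ binary_value w = n.

(* The lengths l_1, ..., l_s are the values of [l : nat -> nat] on 1, ..., s;
   its other values are irrelevant. The digit of the i-th block, 2 <= i <= s,
   is 1 exactly when s - i is even. *)
Definition block_word (s : nat) (l : nat -> nat) : seq bool :=
  flatten [seq nseq (l i) (~~ odd (s - i)) | i <- rev (iota 2 s.-1)]
    ++ true :: nseq (l 1) false.

Definition block_lengths (n s : nat) (l : nat -> nat) : Prop :=
  [/\ 1 <= s, (forall i, 2 <= i <= s -> 1 <= l i)
    & binary_expansion n (block_word s l)].

Definition kpos (l : nat -> nat) (i : nat) : nat :=
  if i == 1 then l 1 else 1 + \sum_(1 <= j < i.+1) l j.

(* alpha_{i, l_i}; index 0 is a dummy. The subtraction never truncates, see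
   [alpha_end_le] below. *)
Fixpoint alpha_end (l : nat -> nat) (i : nat) : nat :=
  match i with
  | 0 => 0
  | 1 => 1
  | 2 | 3 => 2 ^ (l 1).+1
  | (i'.+3 as i1).+1 => 2 ^ (kpos l i'.+2).+1 - alpha_end l i1
  end.

Definition alpha (l : nat -> nat) (i j : nat) : nat :=
  if j < l i then 2 ^ (kpos l i - j) else alpha_end l i.

Definition jacobsthal_exponent (s : nat) (l : nat -> nat) (j : nat) : nat :=
  \sum_(1 <= i < s.+1 | j <= l i) alpha l i j.

Definition max_block (s : nat) (l : nat -> nat) : nat := \max_(1 <= i < s.+1) l i.

Lemma alpha_end_le (l : nat -> nat) (i : nat) :
  alpha_end l i.+3 <= 2 ^ (kpos l i.+2).+1.
Proof.
have le_k : forall m, kpos l m.+1 <= kpos l m.+2.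
  case=> [|m]; rewrite /kpos /=; last by rewrite leq_add2l [leqRHS]big_nat_recr ?leq_addr.
  by rewrite big_nat_recr //= big_nat1; lia.
case: i => [|i]; first by rewrite leq_exp2l // ltnS (le_k 0).
rewrite [alpha_end _ _]/=; apply: leq_trans (leq_subr _ _) _.
by rewrite leq_exp2l // ltnS le_k.
Qed.

Lemma binary_value_last (w : seq bool) (b : bool) :
  binary_value (rcons w b) = 2 * binary_value w + b.
Proof. by rewrite /binary_value -cats1 foldl_cat. Qed.

Lemma binary_value_tail (w : seq bool) (k : nat) :
  binary_value (w ++ true :: nseq k false) = (2 * binary_value w + 1) * 2 ^ k.
Proof.
elim: k => [|k IHk]; first by rewrite cats1 binary_value_last muln1.
have -> : nseq k.+1 false = rcons (nseq k false) false.
  by rewrite -cats1 cat_nseq; elim: k {IHk} => //= k ->.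
by rewrite -rcons_cons -rcons_cat binary_value_last IHk expnS addn0 mulnCA.
Qed.

Lemma binary_expansion_exists (n : nat) :
  0 < n -> exists w : seq bool, binary_expansion n w.
Proof.
elim/ltn_ind: n => -[//|[|n]] IHn _; first by exists [:: true].
have [||w [w1 wE]] := IHn (n.+2./2); [lia | lia |].
exists (rcons w (odd n.+2)); split; first by case: w w1 {wE}.
by rewrite binary_value_last wE mul2n addnC odd_double_half.
Qed.

Lemma maximal_runs (c : bool) (w : seq bool) :
  exists s (l : nat -> nat), [/\ 2 <= s, forall i, 2 <= i <= s -> 1 <= l i
    & c :: w = flatten [seq nseq (l i) (c (+) odd (s - i)) | i <- rev (iota 2 s.-1)]].
Proof.
have top m : rev (iota 2 m.+1) = m.+2 :: rev (iota 2 m).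
  by rewrite -[m.+1 in LHS]addn1 iotaD rev_cat /= add2n.
elim: w c => [|d w IHw] c.
  exists 2, (fun=> 1); split=> //=.
  by rewrite addbF.
have [[|[|s]] [l [//= _ lP wE]]] := IHw d.
have low (l1 l2 : nat -> nat) (c1 c2 : bool) (s1 s2 m : nat) :
    (forall i, i <= m.+1 -> l1 i = l2 i /\ c1 (+) odd (s1 - i) = c2 (+) odd (s2 - i)) ->
    [seq nseq (l1 i) (c1 (+) odd (s1 - i)) | i <- rev (iota 2 m)]
    = [seq nseq (l2 i) (c2 (+) odd (s2 - i)) | i <- rev (iota 2 m)].
  by move=> eq12; apply/eq_in_map => i; rewrite mem_rev mem_iota => /andP[_ ?];
     have [|-> ->] := eq12 i; first lia.
have [eq_dc|neq_dc] := eqVneq d c.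
  exists s.+2, (fun i => if i == s.+2 then (l i).+1 else l i); split=> //.
    by move=> i /lP; case: eqP.
  rewrite wE top /= eqxx subnn !addbF eq_dc /=; congr (_ :: (_ ++ flatten _)).
  by apply: low => i le_i; rewrite ltn_eqF //.
exists s.+3, (fun i => if i == s.+3 then 1 else l i); split=> //.
  by move=> i; case: eqP => // ? ?; apply: lP; lia.
rewrite wE [s.+3.-1]/= (top s.+1) /= eqxx subnn addbF /=; congr (_ :: flatten _).
apply: (low _ _ _ _ _ _ s.+1) => i le_i; rewrite ltn_eqF //; split=> //.
by rewrite (subSn le_i) /=; case: d c neq_dc {wE IHw} => [] [] //= _; rewrite negbK.
Qed.

Lemma block_lengths_exist (n : nat) :
  0 < n -> exists s (l : nat -> nat), block_lengths n s l.
Proof.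
move=> n_gt0; set k := logn 2 n.
have [m nE] : exists m, n = (2 * m + 1) * 2 ^ k.
  have [//|q coq qE] := @pfactor_coprime 2 n isT; exists q./2.
  rewrite [LHS]qE; congr (_ * _); rewrite coprime2n in coq.
  by rewrite -[LHS]odd_double_half coq mul2n addnC.
case: m nE => [|m] nE.
  exists 1, (fun=> k); split=> //; first by case=> [|[]].
  by split; rewrite // /block_word /= (binary_value_tail [::]) nE.
have [//|[|b w] [//= w1 wE]] := @binary_expansion_exists m.+1.
have [s [l [s_gt1 lP bwE]]] := maximal_runs b w.
rewrite w1 in wE bwE.
exists s, (fun i => if i == 1 then k else l i).
have wordE : block_word s (fun i => if i == 1 then k else l i)
    = (true :: w) ++ true :: nseq k false.
  rewrite /block_word bwE; congr (flatten _ ++ _); apply/eq_in_map => i.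
  by rewrite mem_rev mem_iota; case: i => [|[]].
split; first exact: ltnW.
  by move=> i i_s; case: eqP => [i1|_]; [rewrite i1 in i_s | exact: lP].
by split; rewrite wordE // binary_value_tail wE nE.
Qed.

(* Main.v *)
Require Import Defs.
From mathcomp Require Import all_boot all_order all_algebra.
From mathcomp Require Import perm.
From mathcomp Require Import zify ring.

Set Implicit Arguments.
Unset Strict Implicit.
Unset Printing Implicit Defensive.

Import Order.TTheory GRing.Theory Num.Theory.
Local Open Scope ring_scope.

(** Everything is reduced to square integer matrices by sorting the rows and
    the columns of a Hankel matrix by parity of their index: since d(2k) = 1
    and d(2k+1) = 1 - d(k), the sorted matrix splits into constant blocks and
    blocks that are again built from the Hankel matrix of half the size. Write
    D(m) and E(m) for the two Hankel determinants of order m, and T(m) for the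
    determinant of order m+1 whose first m columns are those of
    [d(i+j)] and whose last column is constant 1. Splitting into blocks gives

      D(2m) = D(m) (2 E(m) - (-1)^m D(m)),   E(2m) = (-1)^m D(m)^2,
      D(2m+1) = (-1)^m T(m)^2,               E(2m+1) = 0,
      T(m)^2 = T(floor(m/2))^2 D(ceil(m/2))^2.

    The first line comes from det [[A, B], [B, A]] = det (A+B) det (A-B) and
    from the fact that det (N + y J), J the all-one matrix, is affine in y; up
    to sign it is the Jacobsthal recurrence, which is why trailing zeros of n
    produce the factors J(l_1+1) and J(l_1).

    The second line makes T the carrier of the remaining digits: writing
    n = (2q+1) 2^k, both determinants of order n are explicit in k and T(q)^2
    (hankel_det_closed_form). By the third line, T(q) is then determined by
    the binary runs of q. Indeed floor(q/2) has the runs of q with the lowest one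
    shortened by one, and, if the lowest run has length r+1, then ceil(q/2) is
    (2q'+1) 2^r, where q' is q without its lowest r+2 digits: for a run of ones
    the carry of ceil turns 0 1^r into 1 0^r, so both digits behave alike.

    The exponents of the Jacobsthal numbers in T(q) are computed run by run
    from a state (x, b), where x is the power 2^(l_2 + ... + l_i) of the
    runs already read and b the coefficient of the end of the next run; one
    run changes it to (x 2^r, 2x - b). The resulting product (runs_product) is
    multiplicative in (x, b), and this linearity turns the recurrence
    for T into an identity that only concerns the two lowest runs
    (runs_product_step). The coefficients alpha(i,j) with i >= 2 are these
    exponents for the initial state (2^(l_1+1), 2^(l_1+1)). *)

Local Notation d := period_doubling (only parsing).
Local Notation e := period_doubling_neg (only parsing).

Lemma period_doubling_even (k : nat) : d k.*2 = 1.
Proof.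
rewrite /d; have -> : logn 2 k.*2.+1 = 0%N by rewrite lognE /= dvdn2 /= odd_double.
by [].
Qed.

Lemma period_doubling_odd (k : nat) : d k.*2.+1 = 1 - d k.
Proof.
rewrite /d -doubleS -mul2n lognM // (lognE 2 2) /=.
by rewrite !addn1 add1n !modn2 /=; case: (odd _).
Qed.

Lemma period_doubling_neg_even (k : nat) : e k.*2 = 0.
Proof. by rewrite /e period_doubling_even subrr. Qed.

Lemma period_doubling_neg_odd (k : nat) : e k.*2.+1 = d k.
Proof. by rewrite /e period_doubling_odd; ring. Qed.

(** * Determinants of matrices given by functions on natural numbers *)

(** Letting the entries be indexed by natural numbers makes the order of the
    matrix a mere parameter, so that it can be rewritten and split freely. *)
Definition det_fun (n : nat) (F : nat -> nat -> int) : int :=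
  \det (\matrix_(i < n, j < n) F i j).

Lemma det_fun_tr (n : nat) (F : nat -> nat -> int) :
  det_fun n (fun i j => F j i) = det_fun n F.
Proof.
by rewrite /det_fun -det_tr; congr (\det _); apply/matrixP => i j; rewrite !mxE.
Qed.

Lemma det_fun_block (p q : nat) (F : nat -> nat -> int) :
  det_fun (p + q) F =
  \det (block_mx (\matrix_(i < p, j < p) F i j)
                 (\matrix_(i < p, j < q) F i (p + j)%N)
                 (\matrix_(i < q, j < p) F (p + i)%N j)
                 (\matrix_(i < q, j < q) F (p + i)%N (p + j)%N)).
Proof.
rewrite /det_fun -[X in \det X = _]submxK.
by congr (\det (block_mx _ _ _ _)); apply/matrixP => i j; rewrite !mxE.
Qed.

(** The sign depends on f alone, not on the matrix; this is what makes the signs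
    cancel when rows and columns are permuted by the same f. *)
Lemma det_fun_reindex_rows (n : nat) (f : nat -> nat) :
  (forall i, (i < n)%N -> (f i < n)%N) ->
  (forall i j, (i < n)%N -> (j < n)%N -> f i = f j -> i = j) ->
  exists b : bool, forall F,
    det_fun n (fun i j => F (f i) j) = (-1) ^+ b * det_fun n F.
Proof.
move=> f_lt f_inj; pose g (i : 'I_n) := Ordinal (f_lt i (ltn_ord i)).
have g_inj : injective g.
  by move=> i j /(congr1 val) /= fij; apply/val_inj/f_inj; rewrite ?ltn_ord.
exists (odd_perm (perm g_inj)) => F; rewrite -det_perm -det_mulmx -row_permE.
by congr (\det _); apply/matrixP => i j; rewrite !mxE permE.
Qed.

Lemma det_fun_reindex (n : nat) (f g : nat -> nat) (F : nat -> nat -> int) :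
  (forall i, (i < n)%N -> (f i < n)%N) ->
  (forall i j, (i < n)%N -> (j < n)%N -> f i = f j -> i = j) ->
  (forall i, (i < n)%N -> (g i < n)%N) ->
  (forall i j, (i < n)%N -> (j < n)%N -> g i = g j -> i = j) ->
  det_fun n (fun i j => F (f i) (g j)) ^+ 2 = det_fun n F ^+ 2.
Proof.
move=> f_lt f_inj g_lt g_inj.
have [b fE] := det_fun_reindex_rows f_lt f_inj.
have [c gE] := det_fun_reindex_rows g_lt g_inj.
rewrite (fE (fun i j => F i (g j))) -det_fun_tr (gE (fun i j => F j i)).
by rewrite (det_fun_tr n F) mulrA -signr_addb exprMn sqrr_sign mul1r.
Qed.

Lemma det_fun_reindex_sym (n : nat) (f : nat -> nat) (F : nat -> nat -> int) :
  (forall i, (i < n)%N -> (f i < n)%N) ->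
  (forall i j, (i < n)%N -> (j < n)%N -> f i = f j -> i = j) ->
  det_fun n (fun i j => F (f i) (f j)) = det_fun n F.
Proof.
move=> f_lt f_inj; have [b fE] := det_fun_reindex_rows f_lt f_inj.
rewrite (fE (fun i j => F i (f j))) -det_fun_tr (fE (fun i j => F j i)).
by rewrite (det_fun_tr n F) signrMK.
Qed.

(** * Block determinants *)

(** Adding the second block row to the first, then subtracting the first block
    column from the second, makes the matrix block triangular. *)
Lemma det_block_circulant (m : nat) (A B : 'M[int]_m) :
  \det (block_mx A B B A) = \det (A + B) * \det (A - B).
Proof.
pose U := block_mx 1%:M 1%:M 0 1%:M : 'M[int]_(m + m).
pose V := block_mx 1%:M (- 1%:M) 0 1%:M : 'M[int]_(m + m).
have <- : \det (U *m block_mx A B B A *m V) = \det (block_mx A B B A).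
  by rewrite !det_mulmx !det_ublock !det1 !mulr1 mul1r.
rewrite !mulmx_block !mul1mx !mul0mx !mulmx0 !mulmx1 !mulmxN !mulmx1 !addr0 !add0r.
rewrite [B + A]addrC addNr -[_ + A]addrC.
by rewrite det_lblock.
Qed.

Lemma det_block_antidiag (m : nat) (A B C : 'M[int]_m) :
  \det (block_mx 0 A B C) = (-1) ^+ m * (\det A * \det B).
Proof.
pose S := block_mx 0 1%:M 1%:M 0 : 'M[int]_(m + m).
have detS : \det S = (-1) ^+ m.
  by rewrite det_block_circulant add0r sub0r det1 mul1r -scaleN1r detZ det1 mulr1.
have : \det (block_mx 0 A B C *m S) = \det A * \det B.
  by rewrite mulmx_block !mulmx0 !mulmx1 !addr0 !add0r det_lblock.
by rewrite det_mulmx detS => <-; rewrite mulrCA -exprMn mulrNN mulr1 expr1n mulr1.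
Qed.

(** Clearing the border column by row operations leaves the Schur complement of
    the corner entry 1. It trades a rank one perturbation for a border. *)
Lemma det_bordered (n : nat) (N : 'M[int]_n) (u : 'rV[int]_n) (v : 'cV[int]_n) :
  \det (block_mx N v u 1%:M : 'M[int]_(n + 1)) = \det (N - v *m u).
Proof.
pose U := block_mx 1%:M (- v) 0 1%:M : 'M[int]_(n + 1).
have <- : \det (U *m block_mx N v u 1%:M) = \det (block_mx N v u 1%:M).
  by rewrite det_mulmx det_ublock !det1 !mul1r.
by rewrite mulmx_block !mul1mx !mul0mx !mulmx1 !add0r subrr mulNmx det_lblock det1 mulr1.
Qed.

(** After bordering, y only occurs in the last row, so that the determinant is
    affine in y; its values at 0 and 1 determine it. *)
Lemma det_add_const (n : nat) (N : 'M[int]_n) (y : int) :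
  \det (N + const_mx y) = (1 - y) * \det N + y * \det (N + const_mx 1).
Proof.
have borderE z :
    \det (N + const_mx z)
    = \det (block_mx N (const_mx 1) (const_mx (- z)) 1%:M : 'M[int]_(n + 1)).
  rewrite det_bordered; congr (\det (_ + _)); apply/matrixP => i j.
  by rewrite !mxE big_ord1 !mxE mul1r opprK.
have -> : \det N = \det (N + const_mx 0).
  by congr (\det _); apply/matrixP => i j; rewrite !mxE addr0.
rewrite !borderE; apply: (determinant_multilinear (i0 := rshift n ord0)).
- apply/rowP => j; case: (split_ordP j) => k ->.
    by rewrite !(block_mxEdl, mxE); ring.
  by rewrite !(block_mxEdr, mxE); ring.
all: apply/matrixP => i j; rewrite [LHS]mxE [RHS]mxE.
all: have [k ->] : exists k : 'I_n, lift (rshift n ord0) i = lshift 1 k.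
  1, 3: by have i_n : (i < n)%N by [have := ltn_ord i; lia];
    exists (Ordinal i_n); apply: val_inj; rewrite /= /bump addn0 leqNgt i_n.
all: by case: (split_ordP j) => h ->; rewrite ?block_mxEul ?block_mxEur.
Qed.

(** * Sorting Hankel matrices by parity *)

Definition evens_first (p i : nat) : nat :=
  if (i < p)%N then i.*2 else (i - p).*2.+1.

Lemma evens_first_lt (p q i : nat) :
  (q <= p <= q.+1)%N -> (i < p + q)%N -> (evens_first p i < p + q)%N.
Proof. by rewrite /evens_first; case: ifP; lia. Qed.

Lemma evens_first_inj (p i j : nat) : evens_first p i = evens_first p j -> i = j.
Proof. by rewrite /evens_first; case: ifP; case: ifP; lia. Qed.

Lemma evens_first_l (p : nat) (i : 'I_p) : evens_first p i = i.*2.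
Proof. by rewrite /evens_first ltn_ord. Qed.

Lemma evens_first_r (p i : nat) : evens_first p (p + i) = i.*2.+1.
Proof. by rewrite /evens_first ltnNge leq_addr addKn. Qed.

Definition hankel_mx (u : nat -> int) (p q : nat) : 'M[int]_(p, q) :=
  \matrix_(i < p, j < q) u (i + j)%N.

Lemma hankel_det_parity (u : nat -> int) (p q : nat) : (q <= p <= q.+1)%N ->
  hankel_det u (p + q) =
  \det (block_mx (\matrix_(i < p, j < p) u (i + j).*2)
                 (\matrix_(i < p, j < q) u (i + j).*2.+1)
                 (\matrix_(i < q, j < p) u (i + j).*2.+1)
                 (\matrix_(i < q, j < q) u (i + j).+1.*2)).
Proof.
move=> pq.
rewrite -[hankel_det _ _]/(det_fun (p + q) (fun i j => u (i + j)%N)).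
rewrite -(@det_fun_reindex_sym _ (evens_first p)); first last.
- by move=> i j _ _; apply: evens_first_inj.
- by move=> i; apply: evens_first_lt.
rewrite det_fun_block; congr (\det (block_mx _ _ _ _)); apply/matrixP => i j;
  rewrite !mxE ?evens_first_l ?evens_first_r; congr u; lia.
Qed.

(** For the complementary sequence the diagonal blocks vanish. *)
Lemma hankel_det_neg_double (m : nat) :
  hankel_det e (m + m) = (-1) ^+ m * hankel_det d m ^+ 2.
Proof.
rewrite hankel_det_parity ?leqnn ?leqnSn //.
rewrite -[hankel_det d m]/(\det (hankel_mx d m m)).
rewrite (_ : block_mx _ _ _ _ = block_mx 0 (hankel_mx d m m) (hankel_mx d m m) 0).
  by rewrite det_block_antidiag expr2.
congr block_mx; apply/matrixP => i j;
  by rewrite !mxE ?period_doubling_neg_even ?period_doubling_neg_odd.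
Qed.

Lemma hankel_det_double (m : nat) :
  hankel_det d (m + m) =
  hankel_det d m * (2 * hankel_det e m - (-1) ^+ m * hankel_det d m).
Proof.
pose H := hankel_mx d m m.
have detN : \det (- H) = (-1) ^+ m * hankel_det d m by rewrite -scaleN1r detZ.
have detC : \det (- H + const_mx 1) = hankel_det e m.
  by congr (\det _); apply/matrixP => i j; rewrite !mxE addrC.
rewrite hankel_det_parity ?leqnn ?leqnSn //.
rewrite (_ : block_mx _ _ _ _ =
  block_mx (const_mx 1) (const_mx 1 - H) (const_mx 1 - H) (const_mx 1)); last first.
  congr block_mx; apply/matrixP => i j;
  by rewrite !mxE ?period_doubling_even ?period_doubling_odd.
rewrite det_block_circulant mulrC opprB addrC subrK; congr (_ * _).
have -> : const_mx 1 + (const_mx 1 - H) = - H + const_mx 2.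
  by apply/matrixP => i j; rewrite !mxE; ring.
by rewrite det_add_const detN detC; ring.
Qed.

(** * Hankel matrices of odd order *)

Definition bordered_fun (m i j : nat) : int := if (j < m)%N then d (i + j) else 1.

Definition bordered_det (m : nat) : int := det_fun m.+1 (bordered_fun m).

Lemma bordered_detE (m : nat) :
  bordered_det m = \det (row_mx (hankel_mx d (m + 1) m) (const_mx 1)).
Proof.
rewrite /bordered_det -addn1; congr (\det _); apply/matrixP => i j; rewrite !mxE.
by rewrite /bordered_fun; case: splitP => k jE; rewrite !mxE ?jE.
Qed.

Lemma bordered_det_neg (m : nat) :
  \det (row_mx (- hankel_mx d (m + 1) m) (const_mx 1)) = (-1) ^+ m * bordered_det m.
Proof.
rewrite bordered_detE.
pose S := block_mx (- 1%:M) 0 0 1%:M : 'M[int]_(m + 1).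
have detS : \det S = (-1) ^+ m by rewrite det_ublock -scaleN1r detZ !det1 !mulr1.
by rewrite -detS mulrC -det_mulmx mul_row_block !mulmx0 mulmxN !mulmx1 addr0 add0r.
Qed.

(** Subtracting the columns from the constant one replaces d by its complement,
    which vanishes at even indices. *)
Lemma bordered_det_compl (m : nat) :
  det_fun m.+1 (fun i j => if (j < m)%N then e (i + j) else 1)
  = (-1) ^+ m * bordered_det m.
Proof.
rewrite bordered_detE.
pose S := block_mx (- 1%:M) 0 (const_mx 1) 1%:M : 'M[int]_(m + 1).
have detS : \det S = (-1) ^+ m by rewrite det_lblock -scaleN1r detZ !det1 !mulr1.
rewrite -detS mulrC -det_mulmx mul_row_block !mulmx0 mulmxN !mulmx1 add0r.
rewrite -addn1; congr (\det _); apply/matrixP => i j; rewrite !mxE.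
by case: splitP => k jE; rewrite !mxE ?big_ord1 ?mxE // jE mulr1 addrC.
Qed.

(** For the complementary sequence, the entries outside the constant column
    whose row and column indices have the same parity vanish. Rows are listed evens first; columns are listed
    with the odd ones first, then the constant column, then the even ones, so
    that the upper right block vanishes and the diagonal blocks are the
    matrices of T(floor(m/2)) and D(ceil(m/2)). The two permutations differ, which
    is why only the square is determined here; the square is all that enters
    D(2m+1). *)
Lemma bordered_det_sqr (m : nat) :
  bordered_det m ^+ 2 = bordered_det m./2 ^+ 2 * hankel_det d (uphalf m) ^+ 2.
Proof.
set r := m./2; set q := uphalf m.
have mE : m.+1 = (r + 1 + q)%N by rewrite /r /q; lia.
transitivity (((-1) ^+ m * bordered_det m) ^+ 2); first by rewrite exprMn sqrr_sign mul1r.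
rewrite -bordered_det_compl.
pose g j := if (j < r)%N then j.*2.+1 else if j == r then m else (j - r.+1).*2.
rewrite -(@det_fun_reindex _ (evens_first (r + 1)) g); first last.
- by rewrite /g => i j; do 4?case: ifP; rewrite /r; lia.
- by rewrite /g => i; do 2?case: ifP; rewrite /r; lia.
- by move=> i j _ _; apply: evens_first_inj.
- by move=> i; rewrite mE; apply: evens_first_lt; rewrite /r /q; lia.
rewrite -exprMn mE det_fun_block bordered_detE.
pose B := \matrix_(i < q, j < r + 1) (j == r :> nat)%:R : 'M[int]_(q, r + 1).
rewrite (_ : block_mx _ _ _ _ =
  block_mx (row_mx (hankel_mx d (r + 1) r) (const_mx 1)) 0 B (hankel_mx d q q)).
  by rewrite det_lblock.
have ltj (j : 'I_q) : (j.*2 < m)%N by have := ltn_ord j; rewrite /q; lia.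
have gl (j : 'I_r) : g j = j.*2.+1 by rewrite /g ltn_ord.
have ltgl (j : 'I_r) : (j.*2.+1 < m)%N by have := ltn_ord j; rewrite /r; lia.
have gr : g r = m by rewrite /g ltnn eqxx.
have gq j : g (r + 1 + j)%N = j.*2.
  by rewrite /g; do 2?case: ifP; lia.
congr block_mx; apply/matrixP => i j; rewrite !mxE.
- rewrite evens_first_l; case: splitP => k jE; rewrite jE ?gl ?ltgl !mxE.
    by rewrite addnS -doubleD period_doubling_neg_odd.
  by rewrite ord1 addn0 gr ltnn.
- by rewrite evens_first_l gq ltj -doubleD period_doubling_neg_even.
- rewrite evens_first_r.
  case: (split_ordP j) => k -> /=.
    by rewrite gl ltgl addnS addSn -doubleD -doubleS period_doubling_neg_even ltn_eqF.
  by rewrite ord1 addn0 gr ltnn eqxx.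
- by rewrite evens_first_r gq ltj addSn -doubleD period_doubling_neg_odd.
Qed.

Lemma det_cast (n n' : nat) (eq_n : n = n') (A : 'M[int]_n) :
  \det (castmx (eq_n, eq_n) A) = \det A.
Proof. by case: _ / eq_n; rewrite castmx_id. Qed.

(** The zero diagonal blocks have different orders. The border that
    absorbs the constant c makes both off-diagonal blocks square. *)
Lemma det_block_rect_add_const (m : nat) (R : 'M[int]_(m + 1, m))
    (S : 'M[int]_(m, m + 1)) (c : int) :
  \det (block_mx 0 R S 0 + const_mx c)
  = (-1) ^+ (m + 1) *
    (\det (row_mx R (const_mx 1)) * \det (col_mx S (const_mx (- c)))).
Proof.
have -> : block_mx 0 R S 0 + const_mx c
    = block_mx 0 R S 0 - const_mx 1 *m (const_mx (- c) : 'rV_(m + 1 + m)).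
  by congr (_ + _); apply/matrixP => i j; rewrite !mxE big_ord1 !mxE mul1r opprK.
rewrite -det_bordered -(det_cast (esym (addnA (m + 1) m 1))).
rewrite -col_mx_const -row_mx_const -block_mxA.
by rewrite det_block_antidiag.
Qed.

Lemma hankel_det_neg_double_succ (m : nat) : hankel_det e (m + 1 + m) = 0.
Proof.
rewrite hankel_det_parity; last by lia.
rewrite (_ : block_mx _ _ _ _ =
  block_mx 0 (hankel_mx d (m + 1) m) (hankel_mx d m (m + 1)) 0 + const_mx 0); last first.
  rewrite addr0; congr block_mx; apply/matrixP => i j;
  by rewrite !mxE ?period_doubling_neg_even ?period_doubling_neg_odd.
(* The border row carries the constant c = 0, so it is a zero row. *)
rewrite det_block_rect_add_const (expand_det_row (col_mx _ _) (rshift m ord0)).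
by rewrite big1 ?mulr0 // => j _; rewrite col_mxEd mxE oppr0 mul0r.
Qed.

Lemma hankel_det_double_succ (m : nat) :
  hankel_det d (m + 1 + m) = (-1) ^+ m * bordered_det m ^+ 2.
Proof.
rewrite hankel_det_parity; last by lia.
pose R := hankel_mx d (m + 1) m.
rewrite (_ : block_mx _ _ _ _ = block_mx 0 (- R) (- R^T) 0 + const_mx 1); last first.
  rewrite -[X in _ = _ + X]submxK add_block_mx.
  congr block_mx; apply/matrixP => i j;
  by rewrite !mxE ?period_doubling_even ?period_doubling_odd ?add0r // addrC ?(addnC j).
rewrite det_block_rect_add_const bordered_det_neg.
have -> : col_mx (- R^T) (const_mx (- 1) : 'rV_(m + 1))
    = (- 1) *: (row_mx R (const_mx 1))^T.
  by rewrite tr_row_mx trmx_const scale_col_mx !scaleN1r; congr col_mx;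
    apply/matrixP => i j; rewrite !mxE.
rewrite detZ det_tr -bordered_detE exprD expr1.
transitivity (((-1) ^+ m) ^+ 2 * ((-1) ^+ m * bordered_det m ^+ 2)); first by ring.
by rewrite sqrr_sign mul1r.
Qed.

(** * Jacobsthal products attached to runs *)

Local Open Scope nat_scope.

Lemma jacobsthal_gt0 (j : nat) : 0 < jacobsthal j.+1.
Proof. by elim: j => [|j IHj] //; rewrite [jacobsthal _]/= ltn_addr. Qed.

Lemma jacobsthalSS (j : nat) :
  jacobsthal j.+2 = jacobsthal j.+1 + 2 * jacobsthal j.
Proof. by []. Qed.

Definition run_factor (r x b : nat) : nat :=
  \prod_(1 <= j < r.+1) jacobsthal j ^ (if j < r then x * 2 ^ (r - j) else b).

(** In terms of x_i = 2^(r_1 + ... + r_(i-1)) and of the end coefficient b_i, the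
    recursion of the end coefficients is b_(i+1) = 2 x_i - b_i; started at
    (1, 1), it yields b_2 = 1 without a special case. Runs are listed from
    the least significant one. *)
Fixpoint runs_product (x b : nat) (rs : seq nat) : nat :=
  if rs is r :: rs' then
    run_factor r x b * runs_product (x * 2 ^ r) (2 * x - b) rs'
  else 1.

Lemma run_factor0 (x b : nat) : run_factor 0 x b = 1.
Proof. by rewrite /run_factor big_nil. Qed.

Lemma run_factorS (r x b : nat) :
  run_factor r.+1 x b = run_factor r (2 * x) (2 * x) * jacobsthal r.+1 ^ b.
Proof.
rewrite /run_factor big_nat_recr //= ltnn; congr (_ * _).
apply: eq_big_nat => j /andP[_ j_r]; rewrite j_r; congr (_ ^ _).
case: ltnP => r_j; first by rewrite subSn 1?ltnW // expnS mulnCA mulnA.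
by rewrite (_ : r.+1 - j = 1) ?muln2 ?mul2n //; lia.
Qed.

Lemma run_factorD (r x x' b b' : nat) :
  run_factor r (x + x') (b + b') = run_factor r x b * run_factor r x' b'.
Proof.
rewrite /run_factor -big_split; apply: eq_bigr => j _ /=.
by rewrite -expnD; case: ifP; rewrite ?mulnDl.
Qed.

(** The state evolves linearly and the exponents are linear in the state; the
    bounds keep the natural subtraction 2x - b exact. *)
Lemma runs_productD (rs : seq nat) (x x' b b' : nat) :
  b <= 2 * x -> b' <= 2 * x' ->
  runs_product (x + x') (b + b') rs = runs_product x b rs * runs_product x' b' rs.
Proof.
elim: rs x x' b b' => //= r rs IHrs x x' b b' bx bx'.
have bound z c : 2 * z - c <= 2 * (z * 2 ^ r).
  by rewrite (leq_trans (leq_subr _ _)) // leq_mul2l leq_pmulr ?expn_gt0.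
rewrite run_factorD mulnACA -IHrs ?bound //; congr (_ * runs_product _ _ _).
  by ring.
lia.
Qed.

Lemma runs_productM (k : nat) (rs : seq nat) (x b : nat) :
  b <= 2 * x -> runs_product (k * x) (k * b) rs = runs_product x b rs ^ k.
Proof.
move=> bx; elim: k => [|k IHk]; last first.
  by rewrite !mulSn runs_productD ?expnS ?IHk // mulnCA leq_mul2l bx orbT.
elim: rs {bx}=> //= r rs; rewrite !mul0n expn0 => ->.
by rewrite /run_factor big1 // => j _; rewrite mul0n if_same.
Qed.

Lemma runs_product_gt0 (rs : seq nat) (x b : nat) : 0 < runs_product x b rs.
Proof.
elim: rs x b => //= r rs IHrs x b; rewrite muln_gt0 IHrs andbT /run_factor.
rewrite big_nat_cond prodn_cond_gt0 // => -[|j] // _.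
by rewrite expn_gt0 jacobsthal_gt0.
Qed.

Lemma run_factor_gt0 (r x b : nat) : 0 < run_factor r x b.
Proof. by have := runs_product_gt0 [:: r] x b; rewrite /= muln1. Qed.

(** Shortening the lowest run by one digit; an empty lowest run is harmless, as
    it contributes no factor and maps the state (1, 1) to itself. *)
Definition trim (rs : seq nat) : seq nat :=
  if rs is r :: rs' then r.-1 :: rs' else [::].

(** The counterpart of T(m)^2 = T(floor(m/2))^2 D(ceil(m/2))^2. If the second run has
    length r'+1, the states after two runs satisfy
      (2^(r+1) 2^(r'+1), 2^(r+2) - 1)
        = (2^r 2^(r'+1), 2^(r+1) - 1) + (2^(r+1) 2^r', 2^(r+1)),
    where the last pair is 2^(r+1) times the state of the trimmed list;
    so the contributions of all further runs agree by additivity. *)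
Lemma runs_product_step (r : nat) (rs : seq nat) : all (leq 1) rs ->
  runs_product 1 1 (r.+1 :: rs) =
  runs_product 1 1 (r :: rs) *
  (jacobsthal r.+1 * run_factor r 1 1 * runs_product 1 1 (trim rs) ^ (2 ^ r.+1)).
Proof.
have facS : run_factor r.+1 1 1 = run_factor r 1 1 * run_factor r 1 1 * jacobsthal r.+1.
  by rewrite run_factorS expn1 (run_factorD r 1 1 1 1).
set Jr := jacobsthal r.+1 in facS *.
case: rs => [_ | r' rs]; first by rewrite /= facS // exp1n; ring.
case: r' => // r' _; rewrite -runs_productM // [trim _]/= /=.
rewrite facS // !mul1n !muln1 !run_factorS !mulnA.
rewrite -[2 - 1]/1 -!expnS.
have -> : 2 ^ r.+2 = 2 ^ r.+1 + 2 ^ r.+1 by rewrite expnS mul2n addnn.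
rewrite run_factorD addnK.
have -> : 2 ^ r.+1 * 2 ^ r'.+1 = 2 ^ r * 2 ^ r'.+1 + 2 ^ r.+1 * 2 ^ r'.
  by rewrite !expnS; ring.
have -> : 2 ^ r.+1 + 2 ^ r.+1 - 1 = (2 ^ r.+1 - 1) + 2 ^ r.+1.
  by have := expn_gt0 2 r.+1; lia.
rewrite runs_productD; first last.
- by rewrite mulnCA leq_pmulr ?muln_gt0 ?expn_gt0.
- by rewrite (leq_trans (leq_subr _ _)) // expnS leq_mul2l leq_pmulr ?expn_gt0.
by ring.
Qed.

(** * Binary runs *)

(** The runs are listed from the least significant one. The top run
    consists of ones, so that the digit of each run is determined by the parity
    of the number of runs above it. *)
Fixpoint runs_value (rs : seq nat) : nat :=
  if rs is r :: rs' then
    2 ^ r * runs_value rs' + ~~ odd (size rs') * (2 ^ r - 1)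
  else 0.

Lemma runs_value_half (r : nat) (rs : seq nat) :
  (runs_value (r.+1 :: rs))./2 = runs_value (r :: rs).
Proof.
have /= := expn_gt0 2 r; rewrite /= !expnS; case: (~~ _); lia.
Qed.

(** If the lowest run consists of zeros, halving leaves its last r zeros below a
    digit 1 of the next run; if it consists of ones, rounding up carries into the
    lowest 0 of the next run (a leading 0 if there is none). In both cases the next run loses one digit. *)
Lemma runs_value_uphalf (r : nat) (rs : seq nat) : all (leq 1) rs ->
  uphalf (runs_value (r.+1 :: rs)) = (runs_value (trim rs)).*2.+1 * 2 ^ r.
Proof.
have pow_gt0 := expn_gt0 2 r.
case: rs => [_|[//|r'] rs _] /=; first by rewrite !expnS; lia.
have pow'_gt0 := expn_gt0 2 r'.
rewrite !expnS; case: (odd _) => /=; rewrite ?mul0n ?mul1n ?addn0; nia.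
Qed.

Local Open Scope ring_scope.

(** * Closed forms *)

Lemma sign_pred (n : nat) : (0 < n)%N ->
  (-1) ^+ (n * (n - 1) %/ 2)%N
  = - (-1) ^+ n * (-1) ^+ ((n - 1) * (n - 2) %/ 2)%N :> int.
Proof.
case: n => // n _; rewrite subn1 subSS /= exprS mulN1r opprK -exprD.
congr (_ ^+ _); rewrite (_ : n.+1 * n = n * 2 + n * (n - 1))%N ?divnMDl //.
by case: n => // n; lia.
Qed.

Lemma sign_double (m : nat) : (0 < m)%N ->
  (-1) ^+ ((m.*2 - 1) * (m.*2 - 2) %/ 2)%N = - (-1) ^+ m :> int.
Proof.
case: m => // m _; rewrite exprS mulN1r opprK.
have -> : (m.+1.*2 - 2 = m * 2)%N by lia.
by rewrite mulnA mulnK // -signr_odd oddM oddB //= odd_double signr_odd.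
Qed.

Lemma sign_double_succ (m : nat) :
  (-1) ^+ ((m.*2.+1 - 1) * (m.*2.+1 - 2) %/ 2)%N = (-1) ^+ m :> int.
Proof.
case: m => // m; have -> : (m.+1.*2.+1 - 1 = m.+1 * 2)%N by lia.
rewrite mulnAC mulnK // -signr_odd oddM (_ : _ - 2 = m.*2.+1)%N; last by lia.
by rewrite /= odd_double andbT -[RHS]signr_odd.
Qed.

(** In absolute value, D(2m) = D(m) (D(m) + 2 E(m)) and E(2m) = D(m)^2. Writing
    D(m) = J(k+1) P and E(m) = J(k) P, both have the common factor
    J(k+1) P^2, and the Jacobsthal recurrence leaves J(k+2) for the first
    and J(k+1) for the second. *)
Lemma hankel_det_closed_form (q k w : nat) : bordered_det q ^+ 2 = w%:Z ^+ 2 ->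
  let n := (q.*2.+1 * 2 ^ k)%N in
  let P := (run_factor k 1 1 * w ^ (2 ^ k.+1))%N in
  hankel_det d n
    = (-1) ^+ ((n - 1) * (n - 2) %/ 2)%N * (jacobsthal k.+1 * P)%N%:Z
  /\ hankel_det e n
    = (-1) ^+ (n * (n - 1) %/ 2)%N * (jacobsthal k * P)%N%:Z.
Proof.
move=> Tq; elim: k => [|k].
  rewrite /= run_factor0 !muln1 !mul1n sign_double_succ mul0n mulr0.
  have -> : q.*2.+1 = (q + 1 + q)%N by lia.
  by rewrite hankel_det_double_succ hankel_det_neg_double_succ Tq -rmorphXn.
set m := (_ * 2 ^ k)%N; set P := (_ * w ^ _)%N; cbv zeta => -[Dm Em].
have m_gt0 : (0 < m)%N by rewrite /m muln_gt0 expn_gt0.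
have -> : (q.*2.+1 * 2 ^ k.+1 = m.*2)%N by rewrite expnS mulnCA mul2n.
have -> : (run_factor k.+1 1 1 * w ^ 2 ^ k.+2 = jacobsthal k.+1 * P ^ 2)%N.
  rewrite run_factorS (run_factorD k 1 1 1 1) /P expnMn -expnM [(2 ^ k.+2)%N]expnSr.
  by rewrite expn1; ring.
rewrite (sign_pred (n := m.*2)) ?double_gt0 // sign_double //.
rewrite -[(-1) ^+ m.*2]signr_odd odd_double expr0.
rewrite -[X in hankel_det d X]addnn -[X in hankel_det e X]addnn.
rewrite hankel_det_neg_double hankel_det_double.
rewrite sign_pred // in Em; rewrite {}Dm {}Em.
have := sqrr_sign int ((m - 1) * (m - 2) %/ 2)%N.
set s := (-1) ^+ (_ %/ 2)%N => ss; set t := (-1) ^+ m.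
clearbody P; rewrite jacobsthalSS -!mulnn !(PoszM, PoszD).
split.
  transitivity (s ^+ 2 * (- t * (((jacobsthal k.+1)%:Z + 2 * (jacobsthal k)%:Z) *
     ((jacobsthal k.+1)%:Z * P%:Z ^+ 2)))); first by ring.
  by rewrite ss mul1r.
transitivity (s ^+ 2 * (t * ((jacobsthal k.+1)%:Z ^+ 2 * P%:Z ^+ 2))); first by ring.
by rewrite ss mul1r; ring.
Qed.

Lemma bordered_det_runs (rs : seq nat) : all (leq 1) (behead rs) ->
  bordered_det (runs_value rs) ^+ 2 = (runs_product 1 1 rs)%:Z ^+ 2.
Proof.
(* The size is added because dropping an empty run leaves the sum unchanged. *)
have [N] := ubnP (sumn rs + size rs).
elim: N rs => // N IHN [|[|r] rs] /= le_N rs_gt0.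
- by rewrite /bordered_det /det_fun det_mx11 mxE.
- have -> : (2 ^ 0 * runs_value rs + ~~ odd (size rs) * (2 ^ 0 - 1)
      = runs_value rs)%N by lia.
  rewrite run_factor0 mul1n IHN //; first by lia.
  by case: rs rs_gt0 {le_N} => //= r rs /andP[].
rewrite -[(_ * _ + _)%N]/(runs_value (r.+1 :: rs)).
rewrite -[(_ * _)%N]/(runs_product 1 1 (r.+1 :: rs)).
rewrite bordered_det_sqr runs_value_half runs_value_uphalf // runs_product_step //.
have Tq : bordered_det (runs_value (trim rs)) ^+ 2 = (runs_product 1 1 (trim rs))%:Z ^+ 2.
  by apply: IHN; case: rs rs_gt0 le_N => [|[|r'] rs'] //=; lia.
have [-> _] := hankel_det_closed_form r Tq.
rewrite exprMn sqrr_sign mul1r IHN //.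
by rewrite !PoszM !exprMn mulrA.
Qed.

Local Open Scope nat_scope.

(** * Block lengths and exponents *)

Lemma binary_value_rcons_run (w : seq bool) (r : nat) (b : bool) :
  binary_value (w ++ nseq r b) = 2 ^ r * binary_value w + b * (2 ^ r - 1).
Proof.
elim: r => [|r IHr]; first by rewrite cats0 muln0 addn0 mul1n.
rewrite -[in LHS]addn1 nseqD catA cats1 binary_value_last IHr expnS.
by have := expn_gt0 2 r; case: b {IHr}; rewrite /=; nia.
Qed.

Lemma binary_value_runs (l : nat -> nat) (m t : nat) :
  binary_value (flatten [seq nseq (l i) (~~ odd (m + t - i.+1)) | i <- rev (iota m t)])
  = runs_value [seq l i | i <- iota m t].
Proof.
elim: t m => [|t IHt] m //=.
rewrite rev_cons map_rcons -cats1 flatten_cat /= cats0 binary_value_rcons_run.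
by rewrite addnS subSS addKn size_map size_iota -IHt addSnnS addnS.
Qed.

Lemma block_lengths_value (n s : nat) (l : nat -> nat) : block_lengths n s l ->
  n = (runs_value [seq l i | i <- iota 2 s.-1]).*2.+1 * 2 ^ l 1.
Proof.
case=> s_gt0 _ [_ <-]; rewrite /block_word binary_value_tail -binary_value_runs.
rewrite addn1 -mul2n; congr ((2 * binary_value (flatten _)).+1 * _).
by apply: eq_map => i; congr (nseq _ (~~ odd _)); lia.
Qed.

Lemma block_lengths_gt0 (n s : nat) (l : nat -> nat) : block_lengths n s l ->
  all (leq 1) [seq l i | i <- iota 2 s.-1].
Proof.
case=> s_gt0 l_gt0 _; apply/allP => _ /mapP[i + ->].
by rewrite mem_iota => ?; apply: l_gt0; lia.
Qed.

Definition block_product (l : nat -> nat) (i : nat) : nat :=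
  \prod_(1 <= j < (l i).+1) jacobsthal j ^ alpha l i j.

Lemma run_factor_alpha (l : nat -> nat) (i x : nat) :
  2 ^ kpos l i = x * 2 ^ l i ->
  run_factor (l i) x (alpha_end l i) = block_product l i.
Proof.
move=> xE; apply: eq_big_nat => j _; rewrite /alpha; case: ifP => // j_l.
have x_gt0 : 0 < x by move: (expn_gt0 2 (kpos l i)); rewrite xE muln_gt0 => /andP[].
have le_k : l i <= kpos l i by rewrite -(@leq_exp2l 2) // xE leq_pmull.
congr (_ ^ _); apply/eqP; rewrite -(@eqn_pmul2r (2 ^ j)) ?expn_gt0 //.
by rewrite -mulnA -!expnD !subnK ?xE // ltnW // (leq_trans j_l).
Qed.

(** The exponent of x is kpos of the previous index, except at index 2, where
    kpos of index 1 lacks the separated digit 1. *)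
Lemma runs_product_alpha (l : nat -> nat) (m t : nat) : 2 <= m ->
  runs_product (2 ^ (1 + \sum_(1 <= j < m) l j)) (alpha_end l m)
    [seq l i | i <- iota m t]
  = \prod_(m <= i < m + t) block_product l i.
Proof.
elim: t m => [|t IHt] m m_gt1; first by rewrite addn0 [RHS]big_geq.
have kE : kpos l m = 1 + \sum_(1 <= j < m.+1) l j by rewrite /kpos; case: eqP => //; lia.
have xE : 2 ^ (1 + \sum_(1 <= j < m) l j) * 2 ^ l m
    = 2 ^ (1 + \sum_(1 <= j < m.+1) l j).
  by rewrite -expnD -addnA -big_nat_recr //= ltnW.
rewrite /= run_factor_alpha ?kE ?xE //.
rewrite -addSnnS [RHS]big_ltn ?ltn_addr //.
rewrite -IHt 1?ltnW //; congr (_ * runs_product _ _ _).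
case: m m_gt1 {IHt kE xE} => [|[|[|m]]] // _.
by rewrite big_nat1 add1n [alpha_end l 2]/= mul2n -addnn addnK.
Qed.

Lemma max_block_product (s : nat) (l : nat -> nat) :
  \prod_(1 <= j < (max_block s l).+1) jacobsthal j ^ jacobsthal_exponent s l j
  = \prod_(1 <= i < s.+1) block_product l i.
Proof.
under eq_bigr do rewrite /jacobsthal_exponent expn_sum big_mkcond.
rewrite exchange_big; apply: eq_big_nat => i /andP[i_gt0 i_s].
rewrite -big_mkcond /block_product; symmetry.
have le_max : (l i).+1 <= (max_block s l).+1.
  rewrite ltnS /max_block (bigD1_seq i) ?iota_uniq ?leq_maxl //=.
  by rewrite mem_index_iota i_gt0.
by rewrite (big_nat_widen _ _ _ _ _ le_max); apply: eq_bigl => j.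
Qed.

Lemma jacobsthal_product_runs (s : nat) (l : nat -> nat) : 1 <= s ->
  \prod_(1 <= j < (max_block s l).+1) jacobsthal j ^ jacobsthal_exponent s l j
  = run_factor (l 1) 1 1
    * runs_product 1 1 [seq l i | i <- iota 2 s.-1] ^ 2 ^ (l 1).+1.
Proof.
move=> s_gt0; rewrite max_block_product big_ltn // -(@run_factor_alpha l 1 1) ?mul1n //.
congr (_ * _); rewrite -runs_productM // muln1.
have := runs_product_alpha l s.-1 (leqnn 2).
by rewrite big_nat1 add1n add2n prednK // => <-.
Qed.

Local Open Scope ring_scope.

Unset Implicit Arguments.

Theorem proposition3p9 (n s : nat) (l : nat -> nat) :
  (1 <= n)%N -> block_lengths n s l ->
  [/\ hankel_det period_doubling n
      = (-1) ^+ ((n - 1) * (n - 2) %/ 2)%N * (jacobsthal (l 1%N + 1))%:Z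
        * \prod_(1 <= j < (max_block s l).+1)
            (jacobsthal j)%:Z ^+ jacobsthal_exponent s l j,
      hankel_det period_doubling_neg n
      = (-1) ^+ (n * (n - 1) %/ 2)%N * (jacobsthal (l 1%N))%:Z
        * \prod_(1 <= j < (max_block s l).+1)
            (jacobsthal j)%:Z ^+ jacobsthal_exponent s l j
    & hankel_det period_doubling_neg n <> 0 <-> ~~ odd n].
Proof.
move=> n_gt0 ln; have s_gt0 : (1 <= s)%N by case: ln.
pose rs := [seq l i | i <- iota 2 s.-1].
have nE := block_lengths_value ln.
have rs_gt0 : all (leq 1) (behead rs).
  by have := block_lengths_gt0 ln; rewrite -/rs; case: rs => //= r rs /andP[].
have := hankel_det_closed_form (l 1%N) (bordered_det_runs rs_gt0).
cbv zeta; rewrite -nE -jacobsthal_product_runs // => -[Dn En].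
have prodE : \prod_(1 <= j < (max_block s l).+1)
      (jacobsthal j)%:Z ^+ jacobsthal_exponent s l j
    = (\prod_(1 <= j < (max_block s l).+1)
        jacobsthal j ^ jacobsthal_exponent s l j)%N%:Z.
  rewrite -[RHS]natz natr_prod; apply: eq_bigr => j _.
  by rewrite natrX natz.
split; rewrite ?prodE ?addn1 -?mulrA -?PoszM //.
have -> : odd n = (l 1%N == 0%N) by rewrite nE oddM /= odd_double oddX /=; case: (l 1%N).
rewrite En; split=> [/eqP|l1].
  by apply: contra => /eqP ->; rewrite mul0n mulr0.
apply/eqP; rewrite mulf_neq0 ?signr_eq0 //.
rewrite eqz_nat -lt0n muln_gt0 jacobsthal_product_runs //.
rewrite muln_gt0 run_factor_gt0 expn_gt0 runs_product_gt0 /= andbT.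
by case: (l 1%N) l1 => // r _; apply: jacobsthal_gt0.
Qed.
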